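(* Let $K$ be a commutative integral domain with identity and $n\ge1$. The following are equivalent: (i) for every linear differential operator $\mathcal F=\sum_{|\alpha|=0}^{\infty}a_\alpha D^\alpha$ of infinite order with coefficients $a_\alpha\in K$ and for every copolynomial $Q\in K[x_1,\dots,x_n]'$ there exists a solution $u\in K[x_1,\dots,x_n]'[[t]]$ of the Cauchy problem $$\frac{\partial u(t,x)}{\partial t}=(\mathcal F u)(t,x),\qquad u(0,x)=Q(x);$$ (ii) the ring $K$ contains the field of rational numbers. Furthermore, in this case the solution of this Cauchy problem is unique and has the form $$u(t,x)=\sum_{k=0}^{\infty}\frac{(\mathcal F^kQ)(x)}{k!}t^k.$$
   Context: A copolynomial over $K$ is a $K$-linear map $T:K[x_1,\dots,x_n]\to K$; $K[x_1,\dots,x_n]'$ is the $K$-module of copolynomials, and $(T,p)$ denotes the value of $T$ at $p$. For $\alpha\in\mathbb N_0^n$, $|\alpha|=\sum_j\alpha_j$, $D^\alpha=\frac{\partial^{|\alpha|}}{\partial x_1^{\alpha_1}\cdots\partial x_n^{\alpha_n}}$, and $(D^\alpha T,p)=(-1)^{|\alpha|}(T,D^\alpha p)$. The operator $\mathcal F=\sum_{|\alpha|=0}^\infty a_\alpha D^\alpha$ on $K[x_1,\dots,x_n]'$ acts by $(\mathcal F T,p)=\sum_{|\alpha|\le m}a_\alpha (D^\alpha T,p)$ where $m=\deg p$. $K[x_1,\dots,x_n]'[[t]]$ is the module of formal power series $u(t,x)=\sum_{k\ge0}u_k(x)t^k$ with $u_k\in K[x_1,\dots,x_n]'$; $\frac{\partial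 u}{\partial t}=\sum_{k\ge1}k u_k t^{k-1}$, $\mathcal F u=\sum_{k\ge0}(\mathcal F u_k)t^k$, $u(0,x)=u_0(x)$. ''$K$ contains the field of rational numbers'' means that $K$ has a subring (with the same identity) isomorphic to $\mathbb Q$. *)

(* Defs.v *)
From HB Require Import structures.
From mathcomp Require Import all_boot all_algebra.
From mathcomp Require Import mpoly.

Set Implicit Arguments.
Unset Strict Implicit.
Unset Printing Implicit Defensive.

Import GRing.Theory.
Local Open Scope ring_scope.

Section Copolynomials.

Variables (K : idomainType) (n : nat).

Definition copoly : Type := {scalar {mpoly K[n]}}.

Definition copoly_scale_fun (c : K) (T : copoly) (p : {mpoly K[n]}) : K :=
  c * T p.

Fact copoly_scale_is_scalar c T : scalar (copoly_scale_fun c T).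
Proof. by move=> d p q; rewrite /copoly_scale_fun linearP mulrDr mulrCA. Qed.

HB.instance Definition _ c T :=
  GRing.isLinear.Build K {mpoly K[n]} K *%R (copoly_scale_fun c T)
    (copoly_scale_is_scalar c T).

Definition copoly_scale (c : K) (T : copoly) : copoly := copoly_scale_fun c T.

Definition copoly_deriv_fun (m : 'X_{1..n}) (T : copoly) (p : {mpoly K[n]}) : K :=
  (-1) ^+ mdeg m * T p^`M[m].

Fact copoly_deriv_is_scalar m T : scalar (copoly_deriv_fun m T).
Proof.
move=> c p q; rewrite /copoly_deriv_fun linearP /= linearP mulrDr.
by rewrite mulrCA.
Qed.

HB.instance Definition _ m T :=
  GRing.isLinear.Build K {mpoly K[n]} K *%R (copoly_deriv_fun m T)
    (copoly_deriv_is_scalar m T).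

Definition copoly_deriv (m : 'X_{1..n}) (T : copoly) : copoly :=
  copoly_deriv_fun m T.

(* The operator is given by an arbitrary family of coefficients.  Since
   [msize p] is [deg p + 1] for p != 0, the index 'X_{1..n < msize p} ranges
   over the multi-indices of length at most [deg p]. *)
Definition diffop_fun (a : 'X_{1..n} -> K) (T : copoly) (p : {mpoly K[n]}) : K :=
  \sum_(m : 'X_{1..n < msize p}) a m * copoly_deriv m T p.

Fact mderivm_eq0 (m : 'X_{1..n}) (p : {mpoly K[n]}) :
  (msize p <= mdeg m)%N -> p^`M[m] = 0.
Proof.
move=> le_pm; apply/mpolyP => m'; rewrite mcoeff_mderivm mcoeff0.
rewrite memN_msupp_eq0 ?mul0rn //; apply/negP => /msize_mdeg_lt.
by rewrite mdegD ltnNge (leq_trans le_pm) // ?leq_addr ?leq_addl.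
Qed.

Fact diffop_fun_widen a T k (p : {mpoly K[n]}) : (msize p <= k)%N ->
  diffop_fun a T p = \sum_(m : 'X_{1..n < k}) a m * copoly_deriv m T p.
Proof.
move=> le_pk; rewrite /diffop_fun.
pose G (m : 'X_{1..n}) := a m * copoly_deriv m T p.
have G0 m : (msize p <= mdeg m)%N -> G m = 0.
  by move=> h; rewrite /G /= /copoly_deriv_fun mderivm_eq0 // linear0 !mulr0.
rewrite [RHS](bigID (fun m : 'X_{1..n < k} => (mdeg m < msize p)%N)) /=.
rewrite [X in _ = _ + X]big1 ?addr0; last first.
  by move=> m; rewrite -leqNgt => /G0.
pose h (m : 'X_{1..n < msize p}) : 'X_{1..n < k} :=
  BMultinom (leq_trans (bmdeg m) le_pk).
rewrite (reindex_omap h (fun m : 'X_{1..n < k} =>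
  insub (bmnm m) : option 'X_{1..n < msize p})) /=.
  apply: eq_bigl => m; rewrite bmdeg /=; symmetry; apply/eqP.
  by rewrite insubT ?bmdeg // => h'; congr Some; apply: val_inj.
by move=> m lt_m; rewrite insubT /=; congr Some; apply: val_inj.
Qed.

Fact diffop_is_scalar a T : scalar (diffop_fun a T).
Proof.
move=> c p q; pose k := maxn (msize (c *: p + q)) (maxn (msize p) (msize q)).
rewrite !(@diffop_fun_widen a T k) ?leq_max ?leqnn ?orbT //.
rewrite mulr_sumr -big_split; apply: eq_bigr => m _ /=.
by rewrite copoly_deriv_is_scalar mulrDr mulrCA.
Qed.

HB.instance Definition _ a T :=
  GRing.isLinear.Build K {mpoly K[n]} K *%R (diffop_fun a T)
    (diffop_is_scalar a T).

Definition diffop (a : 'X_{1..n} -> K) (T : copoly) : copoly := diffop_fun a T.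

(* A formal power series in t, as the sequence of its coefficients. *)
Definition copoly_series : Type := nat -> copoly.

(* Copolynomials are compared by their values on all polynomials. *)
Definition series_eq (u v : copoly_series) : Prop := forall k, u k =1 v k.

Definition series_dt (u : copoly_series) : copoly_series :=
  fun k => copoly_scale k.+1%:R (u k.+1).

Definition diffop_series (a : 'X_{1..n} -> K) (u : copoly_series) :
  copoly_series := fun k => diffop a (u k).

Definition cauchy_solution (a : 'X_{1..n} -> K) (Q : copoly)
    (u : copoly_series) : Prop :=
  series_eq (series_dt u) (diffop_series a u) /\ u 0%N =1 Q.

(* The inverse is a genuine one only when k! is a unit of K. *)
Definition exp_series (a : 'X_{1..n} -> K) (Q : copoly) : copoly_series :=
  fun k => copoly_scale (k`!%:R)^-1 (iter k (diffop a) Q).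

End Copolynomials.

(* Morphisms are unital, so the image of f is a subring of K with the same
   identity, isomorphic to the field of rational numbers. *)
Definition contains_rationals (K : idomainType) : Prop :=
  exists f : {rmorphism rat -> K}, injective f.

(* Main.v *)
Require Import Defs.
From HB Require Import structures.
From mathcomp Require Import all_boot all_algebra.
From mathcomp Require Import mpoly ring.

(** Comparing the coefficients of t^k turns the Cauchy problem into the
recurrence (k+1) u_(k+1) = F u_k with u_0 = Q, so everything hinges on
dividing by positive integers.  An integral domain contains the rationals
exactly when all positive integers are units in it ([contains_rationalsP]).

If they are units, the recurrence can be solved in exactly one way, and
linearity of F identifies the solution as the exponential series.

For the converse, evaluate the recurrence at the polynomial 1.  Derivatives of
positive order annihilate 1, so F acts on the values at 1 as multiplication by
a_0, whence k! (u_k, 1) = a_0^k (Q, 1) ([cauchy_solution_at1]).  With a_0 = 1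
and (Q, 1) = 1, the existence of a solution provides an inverse of k! for every
k.  Taking all coefficients equal to 1, and for Q the evaluation at the origin,
shows that a single operator, of genuinely infinite order, and a single initial
value suffice to force every integer to be invertible. *)

Set Implicit Arguments.
Unset Strict Implicit.
Unset Printing Implicit Defensive.

Import GRing.Theory.
Local Open Scope ring_scope.

Lemma intr_unit (R : unitRingType) (z : int) :
  (forall k, k.+1%:R \is a @GRing.unit R) -> z != 0 ->
  z%:~R \is a @GRing.unit R.
Proof.
move=> unitN; case: z => [[|k]|k] // _; first exact: unitN.
by rewrite NegzE mulrNz unitrN; exact: unitN.
Qed.

(** [ratr] is computed from the reduced fraction of its argument; over a ring
that is not a field, being able to use any other integer fraction is what makes
a common denominator available. *)
Lemma ratr_frac (R : comUnitRingType) (x : rat) (p q : int) :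
    (forall k, k.+1%:R \is a @GRing.unit R) -> q != 0 ->
  x * q%:~R = p%:~R -> ratr x * q%:~R = p%:~R :> R.
Proof.
move=> unitN q0 xq; have uz := intr_unit unitN.
have num_den : numq x * q = p * denq x.
  apply: (@intr_inj rat); rewrite !rmorphM /= -xq numqE.
  by rewrite mulrAC.
rewrite /ratr mulrAC -intrM num_den intrM mulrK //.
by rewrite uz ?denq_neq0.
Qed.

(** The embedding is [ratr], which respects sums and products because both can
be cleared of denominators; its injectivity is automatic since the rationals
form a field. *)
Lemma contains_rationalsP (K : idomainType) :
  contains_rationals K <-> forall k, k.+1%:R \is a @GRing.unit K.
Proof.
split=> [[f _] k | unitN].
  by rewrite -(rmorph_nat f) rmorph_unit // unitfE Num.Theory.pnatr_eq0.
have uz := intr_unit unitN.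
have uden x : (denq x)%:~R \is a @GRing.unit K by rewrite uz ?denq_neq0.
have ratr_denq x : ratr x * (denq x)%:~R = (numq x)%:~R :> K by exact: divrK.
(* Multiplying by this unit clears the denominators of both arguments. *)
have uxy x y : (denq x * denq y)%:~R \is a @GRing.unit K.
  by rewrite uz ?mulf_neq0 ?denq_neq0.
have rB : zmod_morphism (@ratr K).
  move=> x y; apply: (mulIr (uxy x y)).
  rewrite (@ratr_frac _ _ (numq x * denq y - numq y * denq x)) //.
  - by rewrite rmorphB !rmorphM /= -!ratr_denq; ring.
  - by rewrite mulf_neq0 ?denq_neq0.
  - by rewrite rmorphB !rmorphM /= !numqE; ring.
have rM : monoid_morphism (@ratr K).
  split=> [|x y]; first exact: (ratr_nat K 1).
  apply: (mulIr (uxy x y)); rewrite (@ratr_frac _ _ (numq x * numq y)) //.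
  - by rewrite !rmorphM /= -!ratr_denq; ring.
  - by rewrite mulf_neq0 ?denq_neq0.
  - by rewrite !rmorphM /= !numqE; ring.
pose f : {rmorphism rat -> K} := HB.pack (@ratr K)
  (GRing.isZmodMorphism.Build _ _ _ rB) (GRing.isMonoidMorphism.Build _ _ _ rM).
by exists f; exact: fmorph_inj.
Qed.

Section Diffop.
Variables (K : idomainType) (n : nat) (a : 'X_{1..n} -> K).
Implicit Types T Q : copoly K n.

Lemma eq_diffop T T' : T =1 T' -> diffop a T =1 diffop a T'.
Proof.
move=> eqT p; apply: eq_bigr => m _.
by rewrite /= /copoly_deriv_fun eqT.
Qed.

Lemma diffop_scale c T :
  diffop a (copoly_scale c T) =1 copoly_scale c (diffop a T).
Proof.
move=> p; rewrite /= /copoly_scale_fun /= /diffop_fun mulr_sumr.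
apply: eq_bigr => m _.
by rewrite /= /copoly_deriv_fun /= /copoly_scale_fun !(mulrCA c).
Qed.

(** Every derivative of positive order annihilates 1. *)
Lemma diffop_at1 T : diffop a T 1 = a 0%MM * T 1.
Proof.
rewrite /= (@diffop_fun_widen _ _ _ _ 1) ?msize1 //.
pose z : 'X_{1..n < 1} := BMultinom (eq_leq (congr1 S mdeg0)).
rewrite (big_pred1 z) => [|m].
  by rewrite /= /copoly_deriv_fun mdeg0 expr0 mul1r mderivm0m.
apply/esym/eqP/val_inj/eqP; rewrite /= -mdeg_eq0 -leqn0 -ltnS.
exact: bmdeg.
Qed.

(** This relation holds over any domain: wherever a_0 and the value of Q at 1
are units, it makes k! a unit, which is the obstruction to solvability. *)
Lemma cauchy_solution_at1 Q u k :
  cauchy_solution a Q u -> k`!%:R * u k 1 = a 0%MM ^+ k * Q 1.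
Proof.
case=> dt u0; elim: k => [|k IH]; first by rewrite u0.
have := dt k 1; rewrite [RHS]diffop_at1 /= /copoly_scale_fun => step.
by rewrite factS natrM mulrAC step -mulrA [_ * k`!%:R]mulrC IH exprS mulrA.
Qed.

Hypothesis unitN : forall k, k.+1%:R \is a @GRing.unit K.

Lemma fact_unit k : k`!%:R \is a @GRing.unit K.
Proof. by rewrite -(prednK (fact_gt0 k)). Qed.

Lemma exp_series_solution Q : cauchy_solution a Q (exp_series a Q).
Proof.
split=> [k p | p]; last by rewrite /= /copoly_scale_fun invr1 mul1r.
rewrite [RHS]diffop_scale /= /copoly_scale_fun /= /copoly_scale_fun.
by rewrite factS natrM invrM ?fact_unit // mulrCA [RHS]mulrC mulrA divrK 1?mulrC.
Qed.

(** The recurrence determines u_(k+1) from u_k because k+1 can be cancelled. *)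
Lemma cauchy_solution_unique Q u v :
  cauchy_solution a Q u -> cauchy_solution a Q v -> series_eq u v.
Proof.
move=> [dtu u0] [dtv v0]; elim=> [|k IH] p; first by rewrite u0 v0.
apply: (mulrI (unitN k)); have := eq_diffop IH p.
by rewrite -[LHS]dtu -[RHS]dtv.
Qed.

End Diffop.

Theorem theorem6p4 (K : idomainType) (n : nat) (n_gt0 : (0 < n)%N) :
  ((forall (a : 'X_{1..n} -> K) (Q : copoly K n),
      exists u : copoly_series K n, cauchy_solution a Q u)
   <-> contains_rationals K)
  /\
  (contains_rationals K ->
    forall (a : 'X_{1..n} -> K) (Q : copoly K n),
      cauchy_solution a Q (exp_series a Q)
      /\ forall u : copoly_series K n,
           cauchy_solution a Q u -> series_eq u (exp_series a Q)).
Proof.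
split; last first.
  move=> /contains_rationalsP unitN a Q.
  have exp_sol := exp_series_solution a unitN Q.
  by split=> // u u_sol; exact: cauchy_solution_unique u_sol exp_sol.
split=> [solvable | /contains_rationalsP unitN a Q]; last first.
  by exists (exp_series a Q); exact: exp_series_solution.
apply/contains_rationalsP => k.
(* The coefficient of the constant monomial is the value at the origin. *)
have [u u_sol] := solvable (fun=> 1) (mcoeff 0%MM : copoly K n).
have := cauchy_solution_at1 k.+1 u_sol.
rewrite expr1n mul1r /= mcoeff1 eqxx factS natrM -mulrA => inv_k.
by apply/unitrPr; exists (k`!%:R * u k.+1 1).
Qed.
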